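(* Let $1\le k\le n$. Consider a $k$-out-of-$n$ system with one cold standby unit, and let $X_1,\ldots,X_n$, $Z$ and $T$ be the lifetimes of the $n$ active components, the standby unit and the whole system, respectively. If $X_1,\ldots,X_n,Z$ are independent and $X_1,\ldots,X_n$ are geometrically distributed (with possibly different parameters), then, for $t=0,1,\ldots$, the conditional distribution of $T-t-1$ given $X_{1:n}>t$ is the same as the unconditional distribution of $T$. In particular, for $t=0,1,\ldots$, $$P(T-(t+1)>s\mid X_{1:n}>t)=P(T>s),\quad s=-1,0,1,\ldots,$$ and $$E(T-(t+1)\mid X_{1:n}>t)=E\,T.$$
   Context: $X_{1:n}\le\cdots\le X_{n:n}$ are the order statistics of $X_1,\ldots,X_n$ and $X_{n+1:n}:=\infty$. The system lifetime is $T=\min(X_{n-k+1:n}+Z,\,X_{n-k+2:n})$ (so $T=X_{n:n}+Z$ for $k=1$). Lifetimes are non-negative random variables, and expectations are taken in $[0,\infty]$. A random variable $Y$ is geometrically distributed with parameter $p\in(0,1)$ if $P(Y=t)=p(1-p)^t$, $t=0,1,\ldots$. *)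

(* Defs.v *)
From HB Require Import structures.
From mathcomp Require Import all_boot all_order all_algebra.
From mathcomp Require Import all_classical all_reals all_analysis.
From mathcomp Require Import measurable_realfun.

Set Implicit Arguments.
Unset Strict Implicit.
Unset Printing Implicit Defensive.
Import Order.TTheory GRing.Theory Num.Theory.

Local Open Scope classical_set_scope.
Local Open Scope ring_scope.
Local Open Scope ereal_scope.

Definition mutually_independent (d : measure_display) (Omega : measurableType d)
    (R : realType) (P : probability Omega R) (I : finType)
    (Y : I -> {RV P >-> R}) : Prop :=
  forall (J : {set I}) (B : I -> set R), (forall i, measurable (B i)) ->
    P (\bigcap_(i in [set` J]) (Y i @^-1` B i)) =
    \prod_(i in J) P (Y i @^-1` B i).

(* The joint family X_1, ..., X_n, Z, indexed by [option 'I_n]. *)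
Definition with_standby (d : measure_display) (Omega : measurableType d)
    (R : realType) (P : probability Omega R) (n : nat)
    (X : 'I_n -> {RV P >-> R}) (Z : {RV P >-> R}) (o : option 'I_n) :
    {RV P >-> R} :=
  if o is Some i then X i else Z.

(* Geometric law on {0, 1, 2, ...}. *)
Definition geometrically_distributed (d : measure_display)
    (Omega : measurableType d) (R : realType) (P : probability Omega R)
    (Y : {RV P >-> R}) (p : R) : Prop :=
  (0 < p < 1)%R /\
  forall t : nat, P [set w | Y w = t%:R] = (p * (1 - p) ^+ t)%:E.

(* The order statistic X_{j:n}, for 1 <= j <= n + 1; the default value of
   [nth] gives X_{n+1:n} = +oo.  (j = 0 is meaningless.) *)
Definition order_stat (Omega : Type) (R : realType) (n : nat)
    (X : 'I_n -> Omega -> R) (j : nat) (w : Omega) : \bar R :=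
  nth +oo (sort <=%O [seq (X i w)%:E | i <- enum 'I_n]) j.-1.

Definition system_lifetime (Omega : Type) (R : realType) (n k : nat)
    (X : 'I_n -> Omega -> R) (Z : Omega -> R) (w : Omega) : \bar R :=
  Order.min (order_stat X (n - k + 1)%N w + (Z w)%:E)
            (order_stat X (n - k + 2)%N w).

(* P(B | A) and E(Y | A), meaningful when P A > 0. *)
Definition cond_prob (d : measure_display) (Omega : measurableType d)
    (R : realType) (P : probability Omega R) (B A : set Omega) : \bar R :=
  P (B `&` A) / P A.

Definition cond_expectation (d : measure_display) (Omega : measurableType d)
    (R : realType) (P : probability Omega R) (Y : Omega -> \bar R)
    (A : set Omega) : \bar R :=
  (\int[P]_(w in A) Y w) / P A.

(* Main.v *)
(* The lifetimes X_i are almost surely natural numbers, so P(T in B) is the sum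
   over x in N^n of P(X = x, Z in C_x), where C_x is the set of z such that the
   system with component lifetimes x and standby lifetime z has lifetime in B.
   Translating all X_i by c = t + 1 translates the order statistics, hence T, by
   c, so T - c in B is the same condition on Z for X = x + c as T in B is for
   X = x.  By independence and the geometric laws the two terms differ by the
   factor q = prod_i (1 - p_i)^c, which does not depend on x.  Taking B to be
   everything gives q = P(X_{1:n} > t). *)
Require Import Defs.
From HB Require Import structures.
From mathcomp Require Import all_boot all_order all_algebra.
From mathcomp Require Import all_classical all_reals all_analysis.
From mathcomp Require Import measurable_realfun.
From mathcomp Require Import ring.

Set Implicit Arguments.
Unset Strict Implicit.
Unset Printing Implicit Defensive.
Import Order.TTheory GRing.Theory Num.Theory.

Local Open Scope classical_set_scope.
Local Open Scope ring_scope.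
Local Open Scope ereal_scope.

(** * Order statistics and the system lifetime: measurability and translation *)

(** In the sorted list the values at most [c] form a prefix, whose length is the cardinal on the
    right. The entry of index [j.-1] lies beyond this prefix exactly when the length is at most
    [j.-1]. *)
Lemma order_stat_gt (Omega : Type) (R : realType) (n : nat)
    (X : 'I_n -> Omega -> R) (j : nat) (w : Omega) (c : R) :
  (c%:E < order_stat X j w) = (#|[set i | (X i w <= c)%R]%SET| <= j.-1)%N.
Proof.
rewrite /order_stat.
set s := sort _ _.
have ss : sorted <=%O s by exact/sort_sorted/le_total.
have szs : size s = n by rewrite size_sort size_map size_enum_ord.
have cs : count (<= c%:E)%O s = #|[set i | (X i w <= c)%R]%SET|.
  rewrite (permP (permEl (perm_sort _ _))) count_map cardE.
  rewrite -size_filter; congr size; rewrite enumT; apply: eq_filter => i /=.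
  by rewrite inE lee_fin.
rewrite -cs; have [cj|jc] := leqP.
  (* Past the end of the list, the default +oo exceeds [c]. *)
  have [nj|jn] := leqP n j.-1; first by rewrite nth_default ?szs ?ltry.
  by apply: nth_count_gt => //; rewrite cj szs.
by apply/negbTE; rewrite -leNgt; exact: nth_count_le.
Qed.

(** Open upper rays generate the Borel sets, and by [order_stat_gt] the preimage of such a ray is a
    finite union, over the index sets [J] with at most [j.-1] elements, of the events that all
    components outside [J] exceed [c]. *)
Lemma measurable_order_stat (d : measure_display) (Omega : measurableType d)
    (R : realType) (n : nat) (X : 'I_n -> Omega -> R) (j : nat) :
  (forall i, measurable_fun [set: Omega] (X i)) ->
  measurable_fun [set: Omega] (order_stat X j).
Proof.
move=> mX; apply: (measurability _ (ErealGenOInfty.measurableE R)) => //.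
move=> _ [_ [c ->] <-]; rewrite setTI.
have -> : order_stat X j @^-1` `]c%:E, +oo[ =
    \bigcup_(J in [set J : {set 'I_n} | (#|J| <= j.-1)%N])
      \bigcap_(i in [set i | i \notin J]) X i @^-1` `]c, +oo[.
  apply/seteqP; split => w /=.
    rewrite in_itv/= andbT order_stat_gt => wj.
    exists [set i | (X i w <= c)%R]%SET => //= i.
    by rewrite /= inE -ltNge in_itv/= andbT.
  move=> [J /= Jj wJ]; rewrite in_itv/= andbT order_stat_gt.
  apply: leq_trans Jj; apply/subset_leq_card/fintype.subsetP => i; rewrite inE.
  by apply: contraTT => /wJ; rewrite /= in_itv/= andbT -ltNge.
apply: fin_bigcup_measurable => [|J _]; first exact: finite_finset.
apply: fin_bigcap_measurable => [|i _]; first exact: finite_finset.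
by rewrite -[X in measurable X]setTI; exact: mX.
Qed.

(** Adding a real constant preserves and reflects the order, so it commutes with sorting; out of
    range, the default +oo absorbs it. *)
Lemma order_stat_shift (Omega : Type) (R : realType) (n : nat)
    (X : 'I_n -> Omega -> R) (j : nat) (w : Omega) (c : R) :
  order_stat (fun i w => X i w + c)%R j w = order_stat X j w + c%:E.
Proof.
rewrite /order_stat.
rewrite (_ : [seq _ | i <- _] =
  [seq x + c%:E | x <- [seq (X i w)%:E | i <- enum 'I_n]]); last first.
  by rewrite -[RHS]map_comp.
rewrite sort_map (_ : (relpre _ _ : rel _) = <=%O); last first.
  by apply/funext => x; apply/funext => y; rewrite /= leeD2rE.
elim: (sort _ _) j.-1 => [|x s IH] [|m] //=; by [rewrite nth_nil|exact: IH].
Qed.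

Lemma system_lifetime_shift (Omega : Type) (R : realType) (n k : nat)
    (X : 'I_n -> Omega -> R) (Z : Omega -> R) (w : Omega) (c : R) :
  system_lifetime k (fun i w => X i w + c)%R Z w =
  system_lifetime k X Z w + c%:E.
Proof.
rewrite /system_lifetime !order_stat_shift addeAC /Order.min lteD2rE//.
by case: ifP.
Qed.

(** The two sample spaces may differ: this transfers the lifetime on an atom of the law of X to a
    function of the standby lifetime alone, with sample space [R]. *)
Lemma eq_system_lifetime (Omega Omega' : Type) (R : realType) (n k : nat)
    (X : 'I_n -> Omega -> R) (X' : 'I_n -> Omega' -> R) (Z : Omega -> R)
    (Z' : Omega' -> R) (w : Omega) (w' : Omega') :
  (forall i, X i w = X' i w') -> Z w = Z' w' ->
  system_lifetime k X Z w = system_lifetime k X' Z' w'.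
Proof.
move=> XX' ZZ'; rewrite /system_lifetime /order_stat ZZ'.
rewrite (_ : [seq (X i w)%:E | i <- enum 'I_n] =
             [seq (X' i w')%:E | i <- enum 'I_n])//.
by apply: eq_map => i; rewrite XX'.
Qed.

Lemma measurable_system_lifetime (d : measure_display)
    (Omega : measurableType d) (R : realType) (n k : nat)
    (X : 'I_n -> Omega -> R) (Z : Omega -> R) :
  (forall i, measurable_fun [set: Omega] (X i)) ->
  measurable_fun [set: Omega] Z ->
  measurable_fun [set: Omega] (system_lifetime k X Z).
Proof.
move=> mX mZ; apply: measurable_mine; last exact: measurable_order_stat.
apply: emeasurable_funD; first exact: measurable_order_stat.
exact/measurable_EFinP.
Qed.

(** * Geometric laws, decomposition into atoms, and independence *)

(** The masses of the naturals form a geometric series with sum p / (1 - (1 - p)) = 1, which leaves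
    probability 0 for the complement. *)
Lemma geometric_ae_nat (d : measure_display) (Omega : measurableType d)
    (R : realType) (P : probability Omega R) (Y : {RV P >-> R}) (p : R) :
  geometrically_distributed Y p ->
  {ae P, forall w, exists m : nat, Y w = m%:R}.
Proof.
move=> [/andP[p0 p1] Yp].
have mY (m : nat) : measurable [set w | Y w = m%:R].
  rewrite -[X in measurable X]setTI.
  exact: (measurable_funP Y measurableT [set m%:R]).
have mU : measurable (\bigcup_m [set w | Y w = m%:R]).
  exact: bigcup_measurable.
exists (~` \bigcup_m [set w | Y w = m%:R]); split.
- exact: measurableC.
- rewrite probability_setC// measure_bigcup//; last first.
    apply/trivIsetP => i j _ _ ij; apply/seteqP; split => // w [/= ->] /eqP.
    by rewrite eqr_nat (negbTE ij).
  rewrite (_ : \sum_(_ <oo | _) _ = 1) ?subee//.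
  apply/cvg_lim => //.
  rewrite (_ : (fun _ => _) = EFin \o series (geometric p (1 - p)%R)).
    apply: cvg_EFin; first by near=> m.
    have := @cvg_geometric_series R p (1 - p)%R.
    rewrite subKr divff ?gt_eqF//; apply.
    by rewrite ger0_norm ?subr_ge0 ?ltW// ltrBlDr ltrDl.
  apply/funext => m; rewrite /series /= -sumEFin.
  by apply: eq_big => [i|i _]; rewrite ?in_setT// Yp.
- by apply: subsetC => w [m _ /= Yw]; exists m.
Unshelve. all: by end_near.
Qed.

(** Countable additivity for a partition, up to a null set, indexed by a countable type. The series
    runs over codes in [nat]; a code that [pickle_inv] does not decode contributes 0. *)
Lemma measure_atoms (d : measure_display) (Omega : measurableType d)
    (R : realType) (P : probability Omega R) (I : countType)
    (E : I -> set Omega) (D : set Omega) :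
  (forall x, measurable (E x)) ->
  (forall x y w, E x w -> E y w -> x = y) ->
  measurable D -> {ae P, forall w, D w -> exists x, E x w} ->
  P D =
    \sum_(m <oo) (if @pickle_inv I m is Some x then P (D `&` E x) else 0).
Proof.
move=> mE tE mD DE.
pose F (m : nat) : set Omega :=
  if @pickle_inv I m is Some x then D `&` E x else set0.
have mF m : measurable (F m).
  by rewrite /F; case: pickle_inv => // x; exact: measurableI.
have mU : measurable (\bigcup_m F m) by exact: bigcup_measurable.
have FD : D `&` \bigcup_m F m = \bigcup_m F m.
  apply: setIidr => w [m _]; rewrite /F; by case: pickle_inv => // x [].
(* The part of [D] outside all pieces lies in the exceptional null set of [DE]. *)
rewrite (measureDI _ mD mU) FD measure_negligible ?add0e; last 2 first.
- exact: measurableD.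
- apply: negligibleS DE => w [/= Dw nU] /(_ Dw)[x Ex]; apply: nU.
  by exists (pickle x) => //; rewrite /F pickleK_inv.
transitivity (\sum_(m <oo) P (F m)); last first.
  by apply: eq_eseriesr => m _; rewrite /F; case: pickle_inv.
apply: measure_semi_bigcup => //.
apply/trivIsetP => i j _ _ ij; apply/seteqP; split => // w [].
rewrite /F; case Ei : (@pickle_inv I i) => [x|//] [_ Ex].
case Ej : (@pickle_inv I j) => [y|//] [_ Ey].
(* A point in two pieces forces equal elements by [tE], hence equal codes. *)
have := @pickle_invK I i; have := @pickle_invK I j; rewrite Ei Ej /= => yj xi.
by move: ij; rewrite -yj -xi (tE _ _ _ Ex Ey) eqxx.
Qed.

Lemma independent_atom (d : measure_display) (Omega : measurableType d)
    (R : realType) (P : probability Omega R) (n : nat)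
    (X : 'I_n -> {RV P >-> R}) (Z : {RV P >-> R}) :
  mutually_independent (with_standby X Z) ->
  forall (x : 'I_n -> R) (C : set R), measurable C ->
  P ([set w | forall i, X i w = x i] `&` Z @^-1` C) =
  (\prod_(i < n) P [set w | X i w = x i]) * P (Z @^-1` C).
Proof.
move=> XZ x C mC.
have := XZ [set: option 'I_n]%SET
  (fun o => if o is Some i then [set x i] else C).
(* The index [None] carries the factor of Z; the others are reindexed by [Some]. *)
rewrite (bigD1 None)/= ?inE//.
rewrite (reindex_omap (Some : 'I_n -> option 'I_n) id)/=; last first.
  by case=> [i|]; rewrite ?eqxx ?andbF.
under eq_bigl do rewrite finset.in_setT eqxx.
rewrite [RHS]muleC => <-; last by case.
congr (P _); apply/seteqP; split => w /=.
  by move=> [Xw Zw] [i|] _ //=; exact: Xw.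
move=> XZw; split; last by have := XZw None; rewrite /= inE; apply.
by move=> i; have := XZw (Some i); rewrite /= inE; apply.
Qed.

(** * Translation of the law of the lifetime *)

Lemma prod_geometric_tail_gt0 (d : measure_display) (Omega : measurableType d)
    (R : realType) (P : probability Omega R) (n : nat) (p : 'I_n -> R)
    (X : 'I_n -> {RV P >-> R}) (c : nat) :
  (forall i, geometrically_distributed (X i) (p i)) ->
  (0 < \prod_(i < n) (1 - p i) ^+ c)%R.
Proof.
move=> Xp; apply: prodr_gt0 => i _; apply: exprn_gt0.
by have [/andP[_ p1] _] := Xp i; rewrite subr_gt0.
Qed.

Lemma measure_lifetime_shift (d : measure_display) (Omega : measurableType d)
    (R : realType) (P : probability Omega R) (n k : nat)
    (X : 'I_n -> {RV P >-> R}) (Z : {RV P >-> R}) (p : 'I_n -> R) :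
  mutually_independent (with_standby X Z) ->
  (forall i, geometrically_distributed (X i) (p i)) ->
  forall (t : nat) (B : set (\bar R)), measurable B ->
  let T := system_lifetime k X Z in
  P ([set w | B (T w - t.+1%:R%:E)] `&` [set w | forall i, (t%:R < X i w)%R]) =
  (\prod_(i < n) (1 - p i) ^+ t.+1)%:E * P [set w | B (T w)].
Proof.
move=> XZ Xp t B mB T.
(* The atoms of the law of X, translated by c; the sum over E t.+1 x matches
   the sum over E 0 x term by term. *)
pose E c (x : {ffun 'I_n -> nat}) := [set w | forall i, X i w = (x i + c)%:R].
have mT : measurable_fun [set: Omega] T.
  by apply: measurable_system_lifetime => *; exact: measurable_funP.
have mE c x : measurable (E c x).
  rewrite (_ : E c x = \bigcap_(i in [set: 'I_n]) X i @^-1` [set (x i + c)%:R]).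
    apply: fin_bigcap_measurable => [|i _]; first exact: finite_finset.
    by rewrite -[X in measurable X]setTI; exact: measurable_funP.
  by apply/seteqP; split => w /= Ew i; [move=> _; exact: Ew|exact: (Ew i)].
have tE c x y w : E c x w -> E c y w -> x = y.
  move=> Ex Ey; apply/ffunP => i; apply/eqP.
  by rewrite -(eqn_add2r c) -(eqr_nat R) -Ex -Ey.
have aeX : {ae P, forall w i, exists m : nat, X i w = m%:R}.
  by apply: filter_forall => i; exact: geometric_ae_nat (Xp i).
have PE c x C : measurable C -> P (E c x `&` Z @^-1` C) =
    (\prod_(i < n) (p i * (1 - p i) ^+ (x i + c)))%:E * P (Z @^-1` C).
  move=> mC; rewrite (independent_atom XZ)//; congr (_ * _).
  rewrite -prodEFin; apply: eq_bigr => i _.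
  by have [_ ->] := Xp i.
(* The component lifetimes are frozen at [x], and the sample point in [R] is itself the standby
   lifetime. *)
pose C (x : {ffun 'I_n -> nat}) :=
  system_lifetime k (fun i (_ : R) => (x i)%:R%R) idfun @^-1` B.
have mC x : measurable (C x).
  rewrite -[X in measurable X]setTI.
  suff mg : measurable_fun [set: R]
      (system_lifetime k (fun i (_ : R) => (x i)%:R%R) idfun) by exact: mg.
  apply: measurable_system_lifetime => [i|]; last exact: measurable_id.
  exact: measurable_cst.
rewrite (measure_atoms (mE t.+1) (tE t.+1)); last 2 first.
- apply: measurableI.
    have mTt : measurable_fun [set: Omega] (fun w => T w - t.+1%:R%:E).
      exact: emeasurable_funB.
    by rewrite -[X in measurable X]setTI; exact: mTt.
  rewrite (_ : [set w | _] =
      \bigcap_(i in [set: 'I_n]) X i @^-1` `]t%:R, +oo[).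
    apply: fin_bigcap_measurable => [|i _]; first exact: finite_finset.
    by rewrite -[X in measurable X]setTI; exact: measurable_funP.
  apply/seteqP; split => w /= Xw i; first by rewrite /= in_itv/= andbT.
  by have := Xw i I; rewrite /= in_itv/= andbT.
- apply: filterS aeX => w Xw [_ /= tX].
  (* Every component value exceeds [t], so this subtraction of naturals does not truncate. *)
  exists [ffun i => sval (cid (Xw i)) - t.+1]%N => i; rewrite ffunE.
  have := tX i; case: cid => m /= ->; rewrite ltr_nat => tm.
  by rewrite subnK.
rewrite (measure_atoms (mE 0%N) (tE 0%N)); last 2 first.
- by rewrite -[X in measurable X]setTI; exact: mT.
- apply: filterS aeX => w Xw _.
  by exists [ffun i => sval (cid (Xw i))] => i; rewrite ffunE addn0; case: cid.
rewrite -nneseriesZl => [|m _]; last by case: pickle_inv.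
apply: eq_eseriesr => m _; case: pickle_inv => [x|]; last by rewrite mule0.
(* On the translated atom every component is at least [t.+1], so survival past [t] is automatic and
   only a condition on Z remains. *)
rewrite (_ : _ `&` E t.+1 x = E t.+1 x `&` Z @^-1` C x); last first.
  suff TE w : E t.+1 x w -> T w - t.+1%:R%:E =
      system_lifetime k (fun i (_ : R) => (x i)%:R%R) idfun (Z w).
    apply/seteqP; split => w /=.
      by move=> [[BT _] Ew]; split => //; rewrite /C /= -TE.
    move=> [Ew CZ]; split => //; split; first by rewrite TE.
    by move=> i; rewrite (Ew i) ltr_nat addnS ltnS leq_addl.
  move=> Ew; rewrite /T.
  rewrite (@eq_system_lifetime _ R R n k _ (fun i _ => (x i)%:R + t.+1%:R)%R
    _ idfun _ (Z w))//; last by move=> i; rewrite Ew natrD.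
  by rewrite system_lifetime_shift addeK.
rewrite (_ : _ `&` E 0%N x = E 0%N x `&` Z @^-1` C x); last first.
  suff TE w : E 0%N x w -> T w =
      system_lifetime k (fun i (_ : R) => (x i)%:R%R) idfun (Z w).
    apply/seteqP; split => w /=.
      by move=> [BT Ew]; split => //; rewrite /C /= -TE.
    by move=> [Ew CZ]; split => //; rewrite TE.
  by move=> Ew; apply: eq_system_lifetime => // i; rewrite Ew addn0.
rewrite !PE// muleA -EFinM -big_split/=; congr (_%:E * _).
by apply: eq_bigr => i _; rewrite addn0 exprD; ring.
Qed.

(** * Conditional law and conditional expectation given survival of all components *)

Theorem theorem3p3 (d : measure_display) (Omega : measurableType d)
    (R : realType) (P : probability Omega R) (n k : nat)
    (hk : (1 <= k <= n)%N)
    (X : 'I_n -> {RV P >-> R}) (Z : {RV P >-> R})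
    (hX0 : forall i, {ae P, forall w, (0 <= X i w)%R})
    (hZ0 : {ae P, forall w, (0 <= Z w)%R})
    (hindep : mutually_independent (with_standby X Z))
    (p : 'I_n -> R)
    (hgeom : forall i, geometrically_distributed (X i) (p i)) :
  let T := system_lifetime k X Z in
  forall t : nat,
  let A := [set w | t%:R%:E < order_stat X 1 w] in
  [/\ 0 < P A,
      forall B : set (\bar R), measurable B ->
        cond_prob P [set w | B (T w - t.+1%:R%:E)] A = P [set w | B (T w)],
      forall s : int, (-1 <= s)%R ->
        cond_prob P [set w | s%:~R%:E < T w - t.+1%:R%:E] A =
        P [set w | s%:~R%:E < T w]
    & cond_expectation P (fun w => T w - t.+1%:R%:E) A = \int[P]_w T w].
Proof.
move=> T t A.
pose q := (\prod_(i < n) (1 - p i) ^+ t.+1)%R.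
have q0 : (0 < q)%R by exact: prod_geometric_tail_gt0 hgeom.
have AE : A = [set w | forall i, (t%:R < X i w)%R].
  apply/seteqP; split => w; rewrite /A /= order_stat_gt leqn0 cards_eq0.
    move=> /eqP X0 i; rewrite ltNge; apply/negP => Xt.
    by have := finset.in_set0 i; rewrite -X0 inE Xt.
  by move=> Xt; apply/eqP/setP => i; rewrite !inE leNgt Xt.
have shift B : measurable B ->
    P ([set w | B (T w - t.+1%:R%:E)] `&` A) = q%:E * P [set w | B (T w)].
  by rewrite AE; exact: measure_lifetime_shift.
have PA : P A = q%:E.
  have := shift setT measurableT; rewrite setTI => ->.
  by rewrite probability_setT mule1.
have cond B : measurable B ->
    cond_prob P [set w | B (T w - t.+1%:R%:E)] A = P [set w | B (T w)].
  move=> mB; rewrite /cond_prob shift// PA muleAC divee ?mul1e//.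
  by rewrite eqe gt_eqF.
have mT : measurable_fun [set: Omega] T.
  by apply: measurable_system_lifetime => *; exact: measurable_funP.
have mTt : measurable_fun [set: Omega] (fun w => T w - t.+1%:R%:E).
  exact: emeasurable_funB.
have mA : measurable A.
  rewrite /A -[X in measurable X]setTI; apply: emeasurable_fun_o_infty => //.
  by apply: measurable_order_stat => *; exact: measurable_funP.
split => //.
- by rewrite PA lte_fin.
- move=> s _; have := cond _ (emeasurable_itv `]s%:~R%:E, +oo[).
  have itvE (f : Omega -> \bar R) :
      [set w | `]s%:~R%:E, +oo[%classic (f w)] = [set w | s%:~R%:E < f w].
    by apply/seteqP; split => w /=; rewrite in_itv/= andbT.
  by rewrite !itvE.
- have q_ge0 : (0 <= q)%R by exact: ltW.
  (* By [shift], the image under T - (t + 1) of P restricted to [A] is [q] times the image of P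
     under T; the integrals of nonnegative functions follow by change of variables. *)
  have ge0_shift (f : \bar R -> \bar R) : (forall x, 0 <= f x) ->
      measurable_fun [set: \bar R] f ->
      \int[P]_(w in A) f (T w - t.+1%:R%:E) = q%:E * \int[P]_w f (T w).
    move=> f0 mf.
    have mfTt := measurableT_comp mf mTt.
    (* Restricting the measure instead of the domain gives an integral over the whole space, as the
       change of variables requires; the restricted measure vanishes outside [A]. *)
    transitivity (\int[mrestr P mA]_w f (T w - t.+1%:R%:E)).
      rewrite [RHS](@ge0_negligible_integral _ _ _ _ setT (~` A))//.
      - rewrite setTD setCK; apply: eq_measure_integral => B mB BA.
        by rewrite /= /mrestr setIidl.
      - exact: measurableC.
      - by rewrite /= /mrestr setICl measure0.
    rewrite -(ge0_integral_pushforward mTt _ measurableT mf)//.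
    rewrite -(ge0_integral_pushforward mT _ measurableT mf)//.
    rewrite -(@ge0_integral_mscale _ _ _ _ _ measurableT (NngNum q_ge0))//.
    by apply: eq_measure_integral => B mB _; exact: shift.
  (* Positive and negative parts depend on the value alone, so [ge0_shift] applies to each of
     them. *)
  have pos (g : Omega -> \bar R) : g^\+ = id^\+ \o g := funepos_comp id g.
  have neg (g : Omega -> \bar R) : g^\- = id^\- \o g := funeneg_comp id g.
  rewrite /cond_expectation PA integralE [RHS]integralE.
  rewrite (pos T) (neg T) (pos (fun _ => _ - _)) (neg (fun _ => _ - _)) /=.
  rewrite (ge0_shift _ (funepos_ge0 _)); last first.
    by apply: measurable_funepos; exact: measurable_id.
  rewrite (ge0_shift _ (funeneg_ge0 _)); last first.
    by apply: measurable_funeneg; exact: measurable_id.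
  (* What remains is (q a - q b) / q = a - b for extended reals, with [q] finite and positive. *)
  have q1 : q%:E / q%:E = 1 by rewrite divee// eqe gt_eqF.
  move: (\int[P]_w _) (\int[P]_w _) => b a.
  (* The remaining cases are oo - oo, which evaluates to -oo on both sides. *)
  have [ab|] := boolP (a +? - b).
    by rewrite -muleBr// muleAC q1 mul1e.
  have Vq : 0 < q%:E^-1 by rewrite inver gt_eqF// lte_fin invr_gt0.
  by case: a b => [a| |] [b| |]//= _;
    rewrite ?(gt0_muley, gt0_muleNy)//= gt0_mulNye.
Qed.
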